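(* Let $A,B\in\mathbb{R}^{m\times n}$, $c\in\mathbb{R}^m$, $T=[\,A+B\;\;\;-A+B\,]\in\mathbb{R}^{m\times2n}$. Suppose that $w^*=(u^*,v^* )\in C_1\cap C_2$ is such that $(u_i^*,v_i^* )\ne(0,0)$ for all $i=1,\dots,n$. If $$\operatorname{Ker}(T)^{\perp}\cap\{w=(u,v)\in\mathbb{R}^n\times\mathbb{R}^n:u_iv_i=0\ \ \forall i=1,\dots,n\}=\{0\},$$ then any sequence generated by $w^{k+1}\in(P_{C_1}\circ P_{C_2})(w^k)$, $k\ge0$, with initial point $w^0$ sufficiently close to $w^*$ converges linearly to a point in $C_1\cap C_2$.
   Context: $C_1:=\{w\in\mathbb{R}^n\times\mathbb{R}^n: Tw=\sqrt2\,c\}$ and $C_2:=\{w=(u,v)\in\mathbb{R}^n\times\mathbb{R}^n: u\ge 0,\ v\ge 0,\ \langle u,v\rangle=0\}$ (inequalities componentwise). For a set $S$, $P_S(z):=\{s\in S:\|s-z\|\le\|t-z\|\ \forall t\in S\}$ is the (possibly multivalued) Euclidean metric projector, and $(P_{C_1}\circ P_{C_2})(w)=\bigcup_{w'\in P_{C_2}(w)}P_{C_1}(w')$. *)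

(* Defs.v *)
From mathcomp Require Import all_boot all_order all_algebra.
From mathcomp Require Import all_classical all_reals all_analysis.

Set Implicit Arguments.
Unset Strict Implicit.
Unset Printing Implicit Defensive.

Import Order.TTheory GRing.Theory Num.Theory.
Import numFieldNormedType.Exports.

Local Open Scope classical_set_scope.
Local Open Scope ring_scope.

(* R^n x R^n is represented by 'cV[R]_(n + n): the point (u, v) is
   [col_mx u v], with u = [usubmx w] and v = [dsubmx w]. *)

Definition inner (R : realType) (k : nat) (x y : 'cV[R]_k) : R :=
  \sum_(i < k) x i 0 * y i 0.

(* The norm that MathComp-Analysis puts on matrices is the sup norm, hence the
   need for a separate Euclidean norm. *)
Definition enorm (R : realType) (k : nat) (x : 'cV[R]_k) : R :=
  Num.sqrt (inner x x).

Definition metric_proj (R : realType) (k : nat) (S : set 'cV[R]_k) (z : 'cV[R]_k) :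
    set 'cV[R]_k :=
  [set s | S s /\ forall t, S t -> enorm (s - z) <= enorm (t - z)].

Definition comp_multi (X Y Z : Type) (F : Y -> set Z) (G : X -> set Y) (x : X) :
    set Z :=
  \bigcup_(y in G x) F y.

Definition kernel_set (R : realType) (m k : nat) (T : 'M[R]_(m, k)) :
    set 'cV[R]_k :=
  [set w | T *m w = 0].

Definition orthogonal_set (R : realType) (k : nat) (S : set 'cV[R]_k) :
    set 'cV[R]_k :=
  [set z | forall s, S s -> inner s z = 0].

Definition Tmat (R : realType) (m n : nat) (A B : 'M[R]_(m, n)) :
    'M[R]_(m, n + n) :=
  row_mx (A + B) (- A + B).

Definition C1 (R : realType) (m n : nat) (A B : 'M[R]_(m, n)) (c : 'cV[R]_m) :
    set 'cV[R]_(n + n) :=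
  [set w | Tmat A B *m w = Num.sqrt 2 *: c].

Definition C2 (R : realType) (n : nat) : set 'cV[R]_(n + n) :=
  [set w | [/\ forall i, 0 <= usubmx w i 0,
               forall i, 0 <= dsubmx w i 0 &
               inner (usubmx w) (dsubmx w) = 0]].

Arguments C2 : clear implicits.

(* Linear convergence in the Q-sense, for the Euclidean norm. It implies the
   R-linear bound [enorm (w k - l) <= M * rho ^+ k]. *)
Definition converges_linearly (R : realType) (k : nat) (w : nat -> 'cV[R]_k)
    (l : 'cV[R]_k) : Prop :=
  w @ \oo --> l /\
  exists2 rho : R, 0 <= rho < 1 &
    \forall j \near \oo, enorm (w j.+1 - l) <= rho * enorm (w j - l).

(* Main.v *)
Require Import Defs.
From mathcomp Require Import all_boot all_order all_algebra.
From mathcomp Require Import all_classical all_reals all_analysis.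
From mathcomp Require Import ring lra.

Set Implicit Arguments.
Unset Strict Implicit.
Unset Printing Implicit Defensive.

Import Order.TTheory GRing.Theory Num.Theory.
Import numFieldNormedType.Exports.

Local Open Scope classical_set_scope.
Local Open Scope ring_scope.

(** Why the iteration converges linearly. Nondegeneracy means that exactly one
    coordinate of each pair is positive at [ws]. Every point of a small ball
    around [ws] inherits this sign pattern strongly enough for its nearest
    point in [C2] to be unique, and obtained by setting to zero the coordinates
    that vanish at [ws] ([metric_proj_C2_near]). So on that ball [P_C2] is the
    orthogonal projector [E] onto a coordinate subspace [L] containing [ws],
    while [P_C1] is the orthogonal projection onto the affine space
    [ws + ker T] ([metric_proj_affine_orth]). In terms of [d k = w k - ws] the
    method is alternating projection between the subspaces [L] and [ker T].
    These projections do not increase norms, so the iterates remain in the ball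
    and the linear description is valid forever.

    For two subspaces of a finite-dimensional space, alternating projections
    converge linearly to the projection of the initial point onto the
    intersection ([alternating_projections_linear]). The contraction factor is
    below one because [1 - E] is injective, hence bounded below, on the
    orthogonal complement in [ker T] of the intersection; the lower bound comes from
    an explicit generalized inverse ([least_norm_ginv]) and needs no compactness
    argument. The limit is no farther from [ws] than the initial point, so it
    has the sign pattern of [ws] and lies in [C2] as well as in [C1]. *)

(** * Euclidean geometry of column vectors *)

Section Inner.
Variables (R : realType) (k : nat).
Implicit Types x y z : 'cV[R]_k.

Lemma inner_trmx x y : inner x y = (x^T *m y) 0 0.
Proof. by rewrite mxE; apply: eq_bigr => i _; rewrite mxE. Qed.

Lemma innerC x y : inner x y = inner y x.
Proof. by apply: eq_bigr => i _; rewrite mulrC. Qed.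

Lemma innerDl x y z : inner (x + y) z = inner x z + inner y z.
Proof. by rewrite !inner_trmx linearD mulmxDl mxE. Qed.

Lemma innerZl a x z : inner (a *: x) z = a * inner x z.
Proof. by rewrite !inner_trmx linearZ -scalemxAl mxE. Qed.

Lemma innerBl x y z : inner (x - y) z = inner x z - inner y z.
Proof. by rewrite innerDl -scaleN1r innerZl mulN1r. Qed.

Lemma innerBr x y z : inner z (x - y) = inner z x - inner z y.
Proof. by rewrite innerC innerBl !(innerC z). Qed.

Lemma inner0l x : inner 0 x = 0.
Proof. by rewrite -(scale0r 0) innerZl mul0r. Qed.

Lemma inner_ge0 x : 0 <= inner x x.
Proof. by apply: sumr_ge0 => i _; rewrite -expr2 sqr_ge0. Qed.

Lemma inner_eq0 x : inner x x = 0 -> x = 0.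
Proof.
move=> x0; apply/matrixP => i j; rewrite ord1 mxE; apply/eqP.
rewrite -[_ == _]orbb -mulf_eq0; apply/eqP.
by apply: (psumr_eq0P _ x0) => // l _; rewrite -expr2 sqr_ge0.
Qed.

Lemma inner_sqrB x y : inner (x - y) (x - y) = inner x x - 2 * inner x y + inner y y.
Proof. by rewrite innerBl !innerBr (innerC y x); ring. Qed.

Lemma enorm_ge0 x : 0 <= enorm x.
Proof. exact: sqrtr_ge0. Qed.

Lemma sqr_enorm x : enorm x ^+ 2 = inner x x.
Proof. by rewrite sqr_sqrtr // inner_ge0. Qed.

Lemma le_enorm x y : (enorm x <= enorm y) = (inner x x <= inner y y).
Proof. by rewrite ler_sqrt // inner_ge0. Qed.

Lemma coord_le_enorm x i : `|x i 0| <= enorm x.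
Proof.
rewrite -sqrtr_sqr ler_sqrt ?inner_ge0 // /inner (bigD1 i) //= -expr2 lerDl.
by apply: sumr_ge0 => l _; rewrite -expr2 sqr_ge0.
Qed.

End Inner.

Lemma inner_mulmxl (R : realType) (p k : nat) (M : 'M[R]_(p, k)) x y :
  inner (M *m x) y = inner x (M^T *m y).
Proof. by rewrite !inner_trmx trmx_mul mulmxA. Qed.

Lemma mulmx_bounded (R : realType) (p k : nat) (G : 'M[R]_(p, k)) :
  exists2 F : R, 0 <= F & forall x, inner (G *m x) (G *m x) <= F * inner x x.
Proof.
exists (\sum_i (\sum_j `|G i j|) ^+ 2) => [|x].
  by apply: sumr_ge0 => i _; exact: sqr_ge0.
rewrite mulr_suml; apply: ler_sum => i _.
rewrite -expr2 -sqr_enorm -exprMn -[leLHS]real_normK ?num_real //.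
rewrite lerXn2r ?nnegrE ?mulr_ge0 ?enorm_ge0 ?sumr_ge0 // mxE.
rewrite mulr_suml; apply: le_trans (ler_norm_sum _ _ _) _.
by apply: ler_sum => j _; rewrite normrM ler_wpM2l ?coord_le_enorm.
Qed.

(** A generalized inverse of [M] for which [G *m M] is the orthogonal projector
    onto the orthogonal complement of the kernel. With [M = C *m V] a full-rank
    factorization, that projector is [V^T (V V^T)^-1 V], where [V V^T] is
    invertible because [v V V^T = 0] forces [v V] to have norm zero. *)
Lemma least_norm_ginv (R : realType) (p k : nat) (M : 'M[R]_(p, k)) :
  exists2 G : 'M[R]_(k, p), (G *m M)^T = G *m M & M *m (G *m M) = M.
Proof.
have [r [C [V [CV VF [C' C'C]]]]] :
    exists r (C : 'M[R]_(p, r)) (V : 'M[R]_(r, k)),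
    [/\ C *m V = M, row_free V & exists C', C' *m C = 1%:M].
  exists (\rank M), (col_base M), (row_base M).
  split; [exact: mulmx_base | exact: row_base_free | exists (pinvmx (col_base M))].
  by rewrite mulVpmx ?col_base_full.
have Gram_unit : V *m V^T \in unitmx.
  rewrite -row_free_unit; apply: inj_row_free => v vVV.
  have vV : (v *m V)^T = 0.
    apply: inner_eq0; rewrite inner_trmx trmxK trmx_mul mulmxA -(mulmxA v).
    by rewrite vVV mul0mx mxE.
  apply: (row_free_inj VF).
  by rewrite mul0mx -[LHS]trmxK vV trmx0.
have GM : (V^T *m invmx (V *m V^T) *m C') *m M = V^T *m invmx (V *m V^T) *m V.
  by rewrite -CV -mulmxA (mulmxA C') C'C mul1mx.
exists (V^T *m invmx (V *m V^T) *m C'); rewrite GM.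
  by rewrite !trmx_mul trmxK trmx_inv trmx_mul trmxK mulmxA.
by rewrite -CV -!mulmxA (mulmxA V) (mulmxA (V *m _)) mulmxV // mul1mx.
Qed.

Lemma projector_pythagoras (R : realType) (k : nat) (E : 'M[R]_k) x :
  E^T = E -> E *m E = E ->
  inner x x = inner (E *m x) (E *m x) + inner (x - E *m x) (x - E *m x).
Proof.
move=> E_sym E_idem.
have EE : inner (E *m x) (E *m x) = inner x (E *m x).
  by rewrite inner_mulmxl E_sym mulmxA E_idem.
by rewrite inner_sqrB EE; ring.
Qed.

(** * Alternating projections between two subspaces *)

Section Alternating.
Variables (R : realType) (p k : nat) (T : 'M[R]_(p, k)) (E : 'M[R]_k).
Hypotheses (E_sym : E^T = E) (E_idem : E *m E = E).

(** [y] is the orthogonal projection of [E *m x] onto [ker T]; the variational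
    form avoids a matrix for this projection. *)
Definition alt_step (x y : 'cV[R]_k) : Prop :=
  T *m y = 0 /\ forall z, T *m z = 0 -> inner (E *m x - y) z = 0.

Lemma alt_step_le_proj x y :
  alt_step x y -> inner y y <= inner (E *m x) (E *m x).
Proof.
move=> [Ty /(_ _ Ty)]; rewrite innerBl => /eqP; rewrite subr_eq0 => /eqP xy.
by have := inner_ge0 (E *m x - y); rewrite inner_sqrB xy; lra.
Qed.

Lemma alt_step_nonexpansive x y : alt_step x y -> enorm y <= enorm x.
Proof.
move=> /alt_step_le_proj yx; rewrite le_enorm (le_trans yx) //.
by rewrite [leRHS](projector_pythagoras x E_sym E_idem) lerDl inner_ge0.
Qed.

(** The limit is the orthogonal projection [d0 - P d0] of the first term onto
    the intersection of the two subspaces, i.e. onto the kernel of the stacked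
    matrix [M = (T ; 1 - E)], with [P = G M] as in [least_norm_ginv]. After
    subtracting it, every term stays orthogonal to the intersection, so a term
    [x] of [ker T] satisfies [x = G M x = G (0 ; x - E x)]. Hence [|x|^2] is at
    most a constant times [|x - E x|^2], and Pythagoras turns this into a
    contraction factor for [E]. *)
Lemma alternating_projections_linear :
  exists2 rho : R, 0 <= rho < 1 &
    forall d : nat -> 'cV[R]_k, (forall j, alt_step (d j) (d j.+1)) ->
    exists l, [/\ T *m l = 0, E *m l = l, enorm l <= enorm (d 0%N) &
      forall j, enorm (d j.+2 - l) <= rho * enorm (d j.+1 - l)].
Proof.
set M := col_mx T (1%:M - E).
have kerM (z : 'cV[R]_k) : M *m z = 0 <-> T *m z = 0 /\ E *m z = z.
  rewrite mul_col_mx mulmxBl mul1mx; split=> [|[-> ->]]; last first.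
    by rewrite subrr col_mx0.
  by rewrite -[RHS]col_mx0 => /eq_col_mx[-> /eqP]; rewrite subr_eq0 => /eqP/esym.
have [G P_sym MP] := least_norm_ginv M; set P := G *m M in P_sym MP.
have P_idem : P *m P = P by rewrite {1}/P -mulmxA MP.
have P_fix x : (forall z, M *m z = 0 -> inner x z = 0) -> P *m x = x.
  move=> orth; apply/esym/eqP; rewrite -subr_eq0; apply/eqP/inner_eq0.
  rewrite innerBl orth; last by rewrite mulmxBr mulmxA MP subrr.
  by rewrite inner_mulmxl P_sym mulmxBr mulmxA P_idem subrr innerC inner0l subr0.
have [F F0 GF] := mulmx_bounded (G : 'M[R]_(k, p + k)).
have /andP[q0 q1] : 0 <= F / (F + 1) < 1.
  by rewrite divr_ge0 ?ltr_pdivrMr ?mul1r ?ltrDl //=; lra.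
exists (Num.sqrt (F / (F + 1))).
  by rewrite sqrtr_ge0 /= -[ltRHS]sqrtr1 ltr_sqrt.
move=> d step; pose l := d 0%N - P *m d 0%N.
have [Tl El] : T *m l = 0 /\ E *m l = l.
  by apply/kerM; rewrite mulmxBr mulmxA MP subrr.
have lE0 z : M *m z = 0 -> inner (d 0%N - l) z = 0.
  move=> Mz; rewrite opprB addrCA subrr addr0 inner_mulmxl P_sym -mulmxA Mz.
  by rewrite mulmx0 innerC inner0l.
have l_le : enorm l <= enorm (d 0%N).
  by rewrite le_enorm [leRHS](projector_pythagoras _ P_sym P_idem) lerDr inner_ge0.
clearbody l; exists l; split=> // j.
have e_step i : alt_step (d i - l) (d i.+1 - l).
  have [Td orth] := step i; split=> [|z Tz]; first by rewrite mulmxBr Td Tl subrr.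
  have -> : E *m (d i - l) - (d i.+1 - l) = E *m d i - d i.+1.
    by rewrite mulmxBr El opprB addrA subrK.
  exact: orth.
have e_orth i z : M *m z = 0 -> inner (d i - l) z = 0.
  move=> Mz; elim: i => [|i IHi]; first exact: lE0.
  have [Tz Ez] := (kerM z).1 Mz; have [_ /(_ _ Tz) eq0] := e_step i.
  rewrite innerBl inner_mulmxl E_sym Ez IHi sub0r in eq0.
  by apply/eqP; rewrite -oppr_eq0 eq0.
have eGM : d j.+1 - l = G *m col_mx 0 ((d j.+1 - l) - E *m (d j.+1 - l)).
  have [Te _] := e_step j.
  by rewrite -[LHS]P_fix ?[in LHS]/P -?mulmxA ?mul_col_mx ?Te ?mulmxBl ?mul1mx //;
    exact: e_orth.
have col0_norm y : inner (col_mx (0 : 'cV[R]_p) y) (col_mx 0 y) = inner y y.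
  by rewrite !inner_trmx tr_col_mx mul_row_col mulmx0 add0r.
have /alt_step_le_proj := e_step j.+1.
have := projector_pythagoras (d j.+1 - l) E_sym E_idem.
have := GF (col_mx 0 ((d j.+1 - l) - E *m (d j.+1 - l))).
rewrite -eGM col0_norm => le_e pyth le_e'.
rewrite /enorm -sqrtrM ?ler_sqrt ?(mulr_ge0 q0) ?inner_ge0 //.
apply: le_trans le_e' _; rewrite mulrAC ler_pdivlMr ?ltr_wpDl //.
have := inner_ge0 ((d j.+1 - l) - E *m (d j.+1 - l)).
move: pyth le_e; set r := inner (_ - _ - _) _; set q := inner (E *m _) _.
by move=> -> le_e r0; rewrite mulrDr mulrDr mulr1 (mulrC q) lerD2l; lra.
Qed.

End Alternating.

(** * Projections in the complementarity problem *)

(** Moving from [s] along [z] stays in the affine space, and a move of length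
    [t = <y - s, z> / (|z|^2 + 1)] strictly decreases the distance to [y] unless
    the inner product vanishes. The added [1] covers the case [z = 0]. *)
Lemma metric_proj_affine_orth (R : realType) (p k : nat) (T : 'M[R]_(p, k)) b y s :
  metric_proj [set w | T *m w = b] y s ->
  forall z, T *m z = 0 -> inner (y - s) z = 0.
Proof.
move=> [/= Ts s_min] z Tz.
pose t := inner (y - s) z / (inner z z + 1).
have := s_min (s + t *: z); rewrite /= mulmxDr -scalemxAr Tz scaler0 addr0.
move=> /(_ Ts); rewrite le_enorm.
have -> : s - y = - (y - s) by rewrite opprB.
have -> : s + t *: z - y = t *: z - (y - s).
  by rewrite opprB [RHS]addrCA addrA.
rewrite inner_sqrB -scaleN1r !innerZl ![inner _ (_ *: _)]innerC !innerZl.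
rewrite (innerC z (y - s)).
have := inner_ge0 z; set a := inner (y - s) z in t *; set q := inner z z in t * => q0 le_t.
have q1 : q + 1 != 0 by rewrite gt_eqF //; lra.
have at1 : a = t * (q + 1) by rewrite /t divfK.
have : t ^+ 2 <= 0.
  move: le_t; rewrite at1 => le_t.
  have : 0 <= t ^+ 2 * q by rewrite mulr_ge0 ?sqr_ge0.
  move: le_t; rewrite !expr2; set X := inner _ _; nra.
by rewrite real_exprn_even_le0 ?num_real //= at1 => /eqP ->; rewrite mul0r.
Qed.

(** For [ws] nondegenerate in [C2], the orthogonal projector onto the span of
    the face of [C2] that contains [ws] in its relative interior. *)
Definition support_proj (R : realType) (k : nat) (ws : 'cV[R]_k) : 'M[R]_k :=
  diag_mx (\row_j (0 < ws j 0)%R%:R).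

Lemma support_projE (R : realType) (k : nat) (ws w : 'cV[R]_k) j :
  (support_proj ws *m w) j 0 = if 0 < ws j 0 then w j 0 else 0.
Proof.
by rewrite mul_diag_mx !mxE; case: ifP => _; rewrite ?mul1r ?mul0r.
Qed.

Lemma tr_support_proj (R : realType) (k : nat) (ws : 'cV[R]_k) :
  (support_proj ws)^T = support_proj ws.
Proof. exact: tr_diag_mx. Qed.

Lemma support_proj_idem (R : realType) (k : nat) (ws : 'cV[R]_k) :
  support_proj ws *m support_proj ws = support_proj ws.
Proof.
rewrite mulmx_diag; congr diag_mx; apply/rowP => j; rewrite !mxE.
by case: (0 < _); rewrite ?mulr1 ?mulr0.
Qed.

Lemma C2_compl (R : realType) (n : nat) (w : 'cV[R]_(n + n)) :
  C2 R n w <-> forall i, [/\ 0 <= w (lshift n i) 0, 0 <= w (rshift n i) 0 &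
                 w (lshift n i) 0 * w (rshift n i) 0 = 0].
Proof.
split=> [[u0 v0 uv] i|uv].
  have := u0 i; have := v0 i; rewrite !mxE => vi ui; split=> //.
  have := psumr_eq0P _ uv; move=> /(_ _ i isT); rewrite !mxE; apply=> l _.
  by apply: mulr_ge0.
split=> [i|i|]; rewrite ?mxE; try by case: (uv i).
by apply: big1 => i _; rewrite !mxE; case: (uv i).
Qed.

Lemma inner_pairs (R : realType) (n : nat) (w : 'cV[R]_(n + n)) :
  inner w w = \sum_i (w (lshift n i) 0 ^+ 2 + w (rshift n i) 0 ^+ 2).
Proof. by rewrite /inner big_split_ord [RHS]big_split. Qed.

(** Keeping the coordinate of larger absolute value is the unique best
    approximation of a pair on the union of the two axes. *)
Lemma axes_gap (R : realType) (x y a b : R) : `|y| < x -> a * b = 0 ->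
  0 <= (a - x) ^+ 2 + (b - y) ^+ 2 - y ^+ 2 /\
  ((a - x) ^+ 2 + (b - y) ^+ 2 - y ^+ 2 <= 0 -> a = x /\ b = 0).
Proof.
move=> yx /eqP; have x0 := le_lt_trans (normr_ge0 y) yx.
have yx2 : y ^+ 2 < x ^+ 2.
  by rewrite -real_normK ?num_real // ltrXn2r ?nnegrE // ltW.
rewrite mulf_eq0 => /orP[] /eqP ->.
  by rewrite sub0r sqrrN; have := sqr_ge0 (b - y); split; lra.
rewrite sub0r sqrrN addrK sqr_ge0; split=> //.
by rewrite real_exprn_even_le0 ?num_real //= subr_eq0 => /eqP.
Qed.

Section NearNondegenerate.
Variables (R : realType) (n : nat) (ws : 'cV[R]_(n + n)) (delta : R).
Hypothesis ws_C2 : C2 R n ws.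
Hypothesis ws_nondeg : forall i : 'I_n, (usubmx ws i 0, dsubmx ws i 0) <> (0, 0).
Hypothesis delta_gap : forall j, 0 < ws j 0 -> 2 * delta <= ws j 0.

Lemma nondeg_pair i :
  (0 < ws (lshift n i) 0 /\ ws (rshift n i) 0 = 0) \/
  (ws (lshift n i) 0 = 0 /\ 0 < ws (rshift n i) 0).
Proof.
have [u0 v0 /eqP] := (C2_compl ws).1 ws_C2 i; have := @ws_nondeg i.
rewrite !mxE mulf_eq0 => nd /orP[] /eqP z.
  right; split=> //; rewrite lt_neqAle v0 andbT; apply/eqP => z'.
  by apply: nd; rewrite z -z'.
left; split=> //; rewrite lt_neqAle u0 andbT; apply/eqP => z'.
by apply: nd; rewrite z -z'.
Qed.

Lemma near_coord w j : enorm (w - ws) < delta ->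
  ws j 0 - delta < w j 0 < ws j 0 + delta.
Proof.
move=> /(le_lt_trans (coord_le_enorm _ j)); rewrite !mxE ltr_norml => /andP[].
by move=> *; apply/andP; split; lra.
Qed.

Lemma support_proj_id : support_proj ws *m ws = ws.
Proof.
apply/colP => j; rewrite support_projE; case: ifPn => //; rewrite -leNgt => le0.
apply/esym/eqP; rewrite eq_le le0 /=.
by case: (split_ordP j) => i ->; case: ((C2_compl ws).1 ws_C2 i).
Qed.

Lemma support_proj_near_C2 w : enorm (w - ws) < delta -> C2 R n (support_proj ws *m w).
Proof.
move=> w_near; apply/C2_compl => i; rewrite !support_projE.
have [[p z]|[z p]] := nondeg_pair i; rewrite p z ltxx ?mulr0 ?mul0r; split=> //.
  by have := near_coord (lshift n i) w_near; have := delta_gap p; lra.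
by have := near_coord (rshift n i) w_near; have := delta_gap p; lra.
Qed.

(** Near [ws], in each pair the coordinate that is positive at [ws] exceeds
    [delta] and the other one is smaller than [delta] in absolute value, so
    [axes_gap] applies. The pairwise excess [D] of the squared distance over
    that of the candidate is therefore nonnegative, and minimality of [s] forces
    each of its terms to vanish. *)
Lemma metric_proj_C2_near w s :
  enorm (w - ws) < delta -> metric_proj (C2 R n) w s -> s = support_proj ws *m w.
Proof.
move=> w_near [s_C2 /(_ _ (support_proj_near_C2 w_near))].
set e := support_proj ws *m w; rewrite le_enorm !inner_pairs -subr_le0 -sumrB => D_le0.
pose D i : R :=
  ((s - w) (lshift n i) 0 ^+ 2 + (s - w) (rshift n i) 0 ^+ 2) -
  ((e - w) (lshift n i) 0 ^+ 2 + (e - w) (rshift n i) 0 ^+ 2).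
have D_pair i : 0 <= D i /\ (D i <= 0 ->
    s (lshift n i) 0 = e (lshift n i) 0 /\ s (rshift n i) 0 = e (rshift n i) 0).
  have [_ _ st0] := (C2_compl s).1 s_C2 i.
  have /andP[u1 u2] := near_coord (lshift n i) w_near.
  have /andP[v1 v2] := near_coord (rshift n i) w_near.
  have subE (x y : 'cV[R]_(n + n)) j : (x - y) j 0 = x j 0 - y j 0 by rewrite !mxE.
  rewrite /D !subE /e !support_projE.
  have [[p z]|[z p]] := nondeg_pair i; have dp := delta_gap p; rewrite p z ltxx in u1 u2 v1 v2 *.
    have vu : `|w (rshift n i) 0| < w (lshift n i) 0.
      by rewrite ltr_norml; apply/andP; split; lra.
    by have := axes_gap vu st0; rewrite subrr sub0r sqrrN expr0n add0r.
  have uv : `|w (lshift n i) 0| < w (rshift n i) 0.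
    by rewrite ltr_norml; apply/andP; split; lra.
  have [] := axes_gap uv (etrans (mulrC _ _) st0).
  rewrite subrr sub0r sqrrN expr0n addr0 (addrC ((s (rshift n i) 0 - _) ^+ 2)) => ge0 eqs.
  by split=> // /eqs[].
have D0 i : D i = 0.
  apply: (psumr_eq0P (P := xpredT) (F := D)) => //; first by move=> l _; case: (D_pair l).
  by apply/eqP; rewrite eq_le D_le0 sumr_ge0 // => l _; case: (D_pair l).
apply/colP => j; case: (split_ordP j) => i ->;
  by have [_] := D_pair i; rewrite D0 lexx => /(_ isT)[].
Qed.

End NearNondegenerate.

Lemma positive_gap (R : realType) (k : nat) (ws : 'cV[R]_k) :
  exists2 delta : R, 0 < delta & forall j, 0 < ws j 0 -> 2 * delta <= ws j 0.
Proof.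
pose mu := \big[Order.min/1]_(j | 0 < ws j 0) ws j 0.
have mu_gt0 : 0 < mu by apply: lt_bigmin.
exists (mu / 2) => [|j wj]; first by rewrite divr_gt0.
by rewrite mulrC divfK ?pnatr_eq0 //; exact: bigmin_le_cond.
Qed.

(** The topology on matrices is entrywise, so convergence is checked on the
    entries of [w j - l], each bounded by the geometric decay of the norm. The
    contraction starts at index 1 because an initial point off [ker T] may fail
    it. *)
Lemma contraction_converges_linearly (R : realType) (k : nat) (w : nat -> 'cV[R]_k) l rho :
  0 <= rho < 1 ->
  (forall j, enorm (w j.+2 - l) <= rho * enorm (w j.+1 - l)) ->
  converges_linearly w l.
Proof.
move=> rho01 contr; have /andP[rho0 rho1] := rho01; split; last first.
  by exists rho => //; exists 1%N => // -[|j].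
have geom j : enorm (w j.+1 - l) <= geometric (enorm (w 1%N - l)) rho j.
  elim: j => [|j IHj]; first by rewrite /= expr0 mulr1.
  by rewrite (le_trans (contr j)) //= exprS mulrCA ler_wpM2l.
rewrite -cvg_shiftS; apply/cvg_ballP => eps eps0.
have /cvgrPdist_lt/(_ _ eps0) : geometric (enorm (w 1%N - l)) rho @ \oo --> 0.
  by apply: cvg_geometric; rewrite ger0_norm.
apply: filterS => j; rewrite sub0r normrN => lt_eps; split=> // i i'.
rewrite ord1 /ball /= distrC.
have := coord_le_enorm (w j.+1 - l) i; rewrite !mxE => /le_lt_trans; apply.
by rewrite (le_lt_trans (geom j)) // (le_lt_trans (ler_norm _)).
Qed.

Theorem theorem3p19 (R : realType) (m n : nat) (A B : 'M[R]_(m, n))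
    (c : 'cV[R]_m) (ws : 'cV[R]_(n + n))
    (ws_mem : (C1 A B c `&` C2 R n) ws)
    (ws_nondeg : forall i : 'I_n, (usubmx ws i 0, dsubmx ws i 0) <> (0, 0))
    (regular : orthogonal_set (kernel_set (Tmat A B)) `&`
      [set w : 'cV[R]_(n + n) | forall i : 'I_n,
         usubmx w i 0 * dsubmx w i 0 = 0] = [set 0]) :
  exists2 delta : R, 0 < delta &
    forall w : nat -> 'cV[R]_(n + n),
      enorm (w 0%N - ws) < delta ->
      (forall k : nat,
         comp_multi (metric_proj (C1 A B c)) (metric_proj (C2 R n)) (w k) (w k.+1)) ->
      exists2 l : 'cV[R]_(n + n),
        (C1 A B c `&` C2 R n) l & converges_linearly w l.
Proof.
have [/= ws_C1 ws_C2] := ws_mem.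
have [delta delta_gt0 gap] := positive_gap ws.
exists delta => // w w0_near iter.
set T := Tmat A B; set E := support_proj ws.
have E_ws : E *m ws = ws by exact: support_proj_id.
have E_sym : E^T = E by exact: tr_support_proj.
have E_idem : E *m E = E by exact: support_proj_idem.
have step k : enorm (w k - ws) < delta -> alt_step T E (w k - ws) (w k.+1 - ws).
  move=> wk_near; have [s s_proj w_proj] := iter k.
  have sE := metric_proj_C2_near ws_C2 ws_nondeg gap wk_near s_proj.
  split=> [|z Tz]; first by case: w_proj => /= Tw _; rewrite mulmxBr Tw ws_C1 subrr.
  rewrite mulmxBr E_ws opprB addrA subrK -sE.
  exact: metric_proj_affine_orth w_proj z Tz.
(* Steps do not increase the distance to [ws], so no term leaves the ball. *)
have w_near k : enorm (w k - ws) < delta.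
  elim: k => // k near_k.
  exact: le_lt_trans (alt_step_nonexpansive E_sym E_idem (step k near_k)) near_k.
have [rho rho01 rate] := alternating_projections_linear T E_sym E_idem.
have [l [Tl El l_le contr]] := rate (fun k => w k - ws) (fun k => step k (w_near k)).
exists (ws + l); last first.
  apply: (contraction_converges_linearly rho01) => j.
  by rewrite !opprD !addrA.
split; first by rewrite /C1 /= mulmxDr -/T Tl addr0.
have <- : E *m (ws + l) = ws + l by rewrite mulmxDr E_ws El.
apply: (support_proj_near_C2 ws_C2 ws_nondeg gap).
by rewrite addrAC subrr add0r (le_lt_trans l_le).
Qed.
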